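(* Let $k$ be an odd positive integer and $n>k$. Then $$r_{n,k}(q,t)=[k+1]_{-q}\,[k+2]_{q}\cdots[n-1]_{(-1)^n q}\cdot[n]_{(-1)^{n+1}qt},$$ that is, $r_{n,k}(q,t)=\Big(\prod_{j=k+1}^{n-1}[j]_{(-1)^{j-1}q}\Big)\,[n]_{(-1)^{n+1}qt}$ (an empty product being $1$).
   Context: For a nonnegative integer $m$ and an expression $x$, $[m]_x=1+x+\cdots+x^{m-1}$. For $0\le k<n$, the rake $R_{n,k}$ is the poset on $n$ elements $x_1,\dots,x_n$ in which $x_i<x_j$ if and only if $i<j$ and $k<j$ (so $x_1,\dots,x_k$, the teeth, are pairwise incomparable minimal elements lying below the chain $x_{k+1}<\cdots<x_n$). A labelling of $R_{n,k}$ is a bijection $w:R_{n,k}\to\{1,\dots,n\}$. For a labelling $w$: $\operatorname{inv}(w)$ is the number of pairs $(x,y)$ with $x<y$ and $w(x)>w(y)$; an element $x$ is a descent of $w$ if $x$ is covered by an element $y$ and $w(x)>w(y)$; $h_x=|\{a: a\le x\}|$ is the hook length of $x$; $\operatorname{maj}(w)=\sum_{x}h_x$, the sum over all descents $x$ of $w$; and $r(w)=n-w(x_n)$. The group $S_k$ acts on labellings by permuting the labels of the teeth $x_1,\dots,x_k$; this preserves $\operatorname{inv}$, $\operatorname{maj}$ and $r$. Let $\mathscr R_{n,k}$ be the set of orbits of labellings of $R_{n,k}$ under this action, and $$r_{n,k}(q,t)=\sum_{w\in\mathscr R_{n,k}}(-1)^{\operatorname{inv}(w)}q^{\operatorname{maj}(w)}t^{r(w)}.$$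 *)

(* Defs.v *)
From HB Require Import structures.
From mathcomp Require Import all_boot all_order all_algebra all_fingroup.

Set Implicit Arguments.
Unset Strict Implicit.
Unset Printing Implicit Defensive.

Import Order.TTheory GRing.Theory.

Section PosetStatistics.
Local Open Scope order_scope.
Variables (d : Order.disp_t) (P : finPOrderType d).
Implicit Types (x y : P) (w : P -> nat).

Definition covered_by x y := (x < y) && ~~ [exists z, (x < z) && (z < y)].

Definition inversions w := #|[set p : P * P | (p.1 < p.2) && (w p.2 < w p.1)%N]|.

Definition descent w x := [exists y, covered_by x y && (w y < w x)%N].

Definition hook_length x := #|[set a : P | a <= x]|.

Definition maj w := (\sum_(x : P | descent w x) hook_length x)%N.

End PosetStatistics.

(* The element i : 'I_n stands for x_{i+1}; hence the strict order
   "i < j and k < j" on the indices 1, ..., n becomes "i < j and k <= j" here,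
   and the teeth are the i < k. *)
Definition rake (n k : nat) : Type := 'I_n.

HB.instance Definition _ n k := Finite.on (rake n k).

Definition rake_lt n k : rel (rake n k) :=
  fun i j => (nat_of_ord i < nat_of_ord j)%N && (k <= nat_of_ord j)%N.

Lemma rake_lt_irr n k : irreflexive (@rake_lt n k).
Proof. by move=> i; rewrite /rake_lt ltnn. Qed.

Lemma rake_lt_trans n k : transitive (@rake_lt n k).
Proof.
move=> j i l /andP[ij _] /andP[jl kl].
by rewrite /rake_lt (ltn_trans ij jl) kl.
Qed.

Fact rake_display : Order.disp_t. Proof. exact: Order.Disp tt tt. Qed.

HB.instance Definition _ n k :=
  Order.Lt_isPOrder.Build rake_display (rake n k)
    (@rake_lt_irr n k) (@rake_lt_trans n k).

Lemma rake_ltE n k (i j : rake n k) :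
  (i < j)%O = ((nat_of_ord i < nat_of_ord j) && (k <= nat_of_ord j))%N.
Proof. by []. Qed.

Lemma rake_top_proof n k : (k < n -> n.-1 < n)%N.
Proof. by case: n. Qed.

Definition rake_top n k (hkn : (k < n)%N) : rake n k :=
  Ordinal (rake_top_proof hkn).

(* Labellings are permutations of 'I_n; the label of x, an element of
   {1, ..., n}, is (w x).+1. *)
Definition label n k (w : 'S_n) (x : rake n k) : nat := (nat_of_ord (w x)).+1.

Definition rake_r n k (hkn : (k < n)%N) (w : 'S_n) : nat :=
  (n - label w (rake_top hkn))%N.

(* S_k is realized as the group Sym (teeth n k) of the permutations of 'I_n
   supported on the teeth. As MathComp actions are right actions, s sends the
   labelling w to x |-> w (s^-1 x). *)
Definition teeth (n k : nat) : {set 'I_n} := [set i : 'I_n | (i < k)%N].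

Definition relabel n (w s : 'S_n) : 'S_n := (s^-1 * w)%g.

Lemma relabel1 n : (@relabel n)^~ 1%g =1 id.
Proof. by move=> w; rewrite /relabel invg1 mul1g. Qed.

Lemma relabelM n (w : 'S_n) : act_morph (@relabel n) w.
Proof. by move=> s t; rewrite /relabel invMg mulgA. Qed.

Canonical relabel_action n := TotalAction (@relabel1 n) (@relabelM n).

Definition rake_orbits n k : {set {set 'S_n}} :=
  [set orbit (relabel_action n) (Sym (teeth n k)) w | w : 'S_n].

(* The three statistics are constant on the orbits, so that evaluating them at
   the representative [repr O] of an orbit O is harmless in [rake_gf]. *)
Section Invariance.
Variables (n k : nat) (s : 'S_n).
Hypothesis hs : s \in Sym (teeth n k).

Lemma toothE (i : 'I_n) :
  (s i = i /\ k <= i)%N \/ ((i < k) /\ (s i < k))%N.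
Proof.
have s_on : perm_on (teeth n k) s by move: hs; rewrite inE.
have [ik | ki] := ltnP i k.
  by right; split=> //; have := perm_closed i s_on; rewrite !inE => ->.
by left; split=> //; apply: (out_perm s_on); rewrite inE -leqNgt.
Qed.

Lemma rake_lt_tooth (x y : rake n k) :
  ((s x : rake n k) < (s y : rake n k))%O = (x < y)%O.
Proof.
rewrite !rake_ltE.
have [[-> kx]|[xk sxk]] := toothE x; have [[-> ky]|[yk syk]] := toothE y => //.
- by rewrite !(leqNgt k) syk yk !andbF.
- by rewrite ky !andbT (leq_trans xk ky) (leq_trans sxk ky).
- by rewrite !(leqNgt k) syk yk !andbF.
Qed.

Lemma rake_le_tooth (x y : rake n k) :
  ((s x : rake n k) <= (s y : rake n k))%O = (x <= y)%O.
Proof. by rewrite !le_eqVlt rake_lt_tooth (inj_eq (@perm_inj _ s)). Qed.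

Lemma label_tooth (w : 'S_n) (x : rake n k) :
  label (relabel w s) (s x : rake n k) = label w x.
Proof. by rewrite /label /relabel permM permK. Qed.

Lemma exists_tooth (p : pred (rake n k)) :
  [exists z : rake n k, p (s z)] = [exists z, p z].
Proof.
apply/existsP/existsP => [[z pz]|[z pz]]; first by exists (s z).
by exists (s^-1%g z); rewrite permKV.
Qed.

Lemma inversions_relabel (w : 'S_n) :
  inversions (label (k := k) (relabel w s)) = inversions (label (k := k) w).
Proof.
pose f (p : rake n k * rake n k) : rake n k * rake n k := (s p.1, s p.2).
have f_inj : injective f.
  by move=> [a b] [a' b'] [/perm_inj -> /perm_inj ->].
rewrite /inversions -[RHS](card_imset _ f_inj); apply: eq_card => -[a b].
have -> : (a, b) = f (s^-1%g a, s^-1%g b) by rewrite /f /= !permKV.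
rewrite mem_imset // !inE /=.
by rewrite rake_lt_tooth !label_tooth.
Qed.

Lemma covered_tooth (x y : rake n k) :
  covered_by (s x : rake n k) (s y : rake n k) = covered_by x y.
Proof.
rewrite /covered_by rake_lt_tooth -exists_tooth; congr (_ && ~~ _).
by apply: eq_existsb => z; rewrite !rake_lt_tooth.
Qed.

Lemma maj_relabel (w : 'S_n) :
  maj (label (k := k) (relabel w s)) = maj (label (k := k) w).
Proof.
rewrite /maj (reindex_inj (@perm_inj _ s)) /=; apply: eq_big => [x|x _].
  rewrite /descent -exists_tooth; apply: eq_existsb => y.
  by rewrite covered_tooth !label_tooth.
rewrite /hook_length -[RHS](card_imset _ (@perm_inj _ s)); apply: eq_card => a.
have -> : a = s (s^-1%g a) by rewrite permKV.
by rewrite (mem_imset _ _ (@perm_inj _ s)) !inE rake_le_tooth.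
Qed.

Lemma rake_r_relabel (hkn : (k < n)%N) (w : 'S_n) :
  rake_r hkn (relabel w s) = rake_r hkn w.
Proof.
rewrite /rake_r; have [[sE _]|[/= tk _]] := toothE (rake_top hkn).
  by rewrite -{1}[rake_top hkn]sE label_tooth.
by move: (leq_trans (leqSpred n) tk); rewrite leqNgt hkn.
Qed.

End Invariance.

Local Open Scope ring_scope.

Definition qint (R : comNzRingType) (m : nat) (x : R) : R :=
  \sum_(i < m) x ^+ i.

(* The polynomial r_{n,k} evaluated at elements of an arbitrary commutative ring;
   R := {poly {poly int}} with the two indeterminates gives r_{n,k} itself. *)
Definition rake_gf (R : comNzRingType) n k (hkn : (k < n)%N) (q t : R) : R :=
  \sum_(O in rake_orbits n k)
     (-1) ^+ inversions (label (k := k) (repr O))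
     * q ^+ maj (label (k := k) (repr O))
     * t ^+ rake_r hkn (repr O).

(* Main.v *)
Require Import Defs.
From mathcomp Require Import all_boot all_order all_algebra all_fingroup.
From mathcomp Require Import zify ring.
Import GRing.Theory.
Local Open Scope ring_scope.

(** The positions are counted from 0, so the chain of the rake R_{n,k} sits at the
positions k, ..., n-1. For a labelling w let r_j be the number of positions i < j
whose label exceeds the label at j: this is the j-th entry of the Lehmer code of
w, and 0 <= r_j <= j. The entries at the chain positions carry everything.

- They determine the orbit of w, and every sequence (r_k, ..., r_(n-1)) with
  r_j <= j comes from exactly one orbit ([orbit_codeP], [code_surj]). Working
  down from the top, r_j singles out the label of j among those not yet used, so
  the chain labels are determined and only the order of the teeth is free.
- They determine the statistics. Position j lies above all earlier positions, so
  inv(w) is the sum of the r_j and r(w) = r_(n-1). The descents among the teeth,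
  each of hook length 1, number r_k; the chain position j is a descent exactly
  when r_j < r_(j+1), and then contributes its hook length j+1
  ([inversions_rake], [maj_rake], [rake_r_lehmer]).

So r_{n,k}(q,t) is a sum over sequences in which the weight of each entry depends
on the preceding entry alone, and it can be evaluated one entry at a time
([code_gf]). The claim that makes the induction run is that the codes with last
entry r contribute P_n x^r, where P_n is the product of the factors other than the
last and x = (-1)^(n+1) q. To pass from n to n+1, one sums over the former last
entry s; with y = (-1)^(n+1) q the new last entry r contributes

  P_n (-1)^r (sum over s < n of y^s q^(n [s < r])).

The signs are such that q^n = y^n, for either n+1 or n is even. The exponents
s + n [s < r] then run through the n consecutive integers r, ..., r+n-1, and the
sum is y^r [n]_y ([geometric_shift]). Hence the contribution is
P_n [n]_y (-y)^r = P_(n+1) (-y)^r, as claimed. The oddness of k is what makes the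
first step right: for n = k+1 the contribution is (-q)^r, which is P_n x^r only if
n is even. Weighting the last entry r by t^r and summing gives the theorem. *)

(** * Lehmer codes *)

Definition lehmer (f : nat -> nat) (j : nat) : nat :=
  (\sum_(i < j) (f j < f i))%N.

(** The entry of largest index comes first: codes then grow by consing, and the
head of a full code is the statistic r. *)
Fixpoint code (f : nat -> nat) (k m : nat) : seq nat :=
  if m is m'.+1 then lehmer f (k + m') :: code f k m' else [::].

Fixpoint codes (k m : nat) : seq (seq nat) :=
  if m is m'.+1 then [seq r :: c | c <- codes k m', r <- iota 0 (k + m').+1]
  else [:: [::]].

(** The major index read off a code alone; see [code_majE] and [maj_rake]. The
entry r' next to the head has index k + size c' - 1, and the hook length of a
chain element is its index plus one. *)
Fixpoint code_maj (k : nat) (c : seq nat) : nat :=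
  if c is r :: c' then
    if c' is r' :: _ then ((k + size c') * (r' < r) + code_maj k c')%N else r
  else 0%N.

Lemma lehmer_le f j : (lehmer f j <= j)%N.
Proof.
rewrite -[leqRHS]card_ord -sum1_card; apply: leq_sum => i _.
exact: leq_b1.
Qed.

(** If f j.+1 < f j, whatever exceeds f j also exceeds f j.+1, and j itself is one
more; otherwise whatever exceeds f j.+1 also exceeds f j. *)
Lemma lehmer_descent f j : (lehmer f j < lehmer f j.+1)%N = (f j.+1 < f j)%N.
Proof.
rewrite [lehmer f j.+1]big_ord_recr /=; have [lt|le] := ltnP (f j.+1) (f j).
  rewrite addn1 ltnS; apply: leq_sum => i _.
  by case: ltnP => // /(ltn_trans lt) ->.
rewrite addn0; apply/negbTE; rewrite -leqNgt; apply: leq_sum => i _.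
by case: (ltnP (f j.+1)) => // /(leq_ltn_trans le) ->.
Qed.

Lemma size_code f k m : size (code f k m) = m.
Proof. by elim: m => //= m ->. Qed.

Lemma code_cat f k m : code f 0 (k + m) = code f k m ++ code f 0 k.
Proof. by elim: m => [|m IHm]; rewrite ?addn0 ?addnS //= add0n IHm. Qed.

Lemma code_lehmerP f g k m :
  code f k m = code g k m <->
  (forall j, k <= j < k + m -> lehmer f j = lehmer g j)%N.
Proof.
elim: m => [|m IHm] /=; first by split=> // _ j; lia.
split=> [[eq_m eq_c] j jm|eq_l].
  have [->//|jkm] := eqVneq j (k + m)%N.
  by apply: IHm.1 => //; lia.
congr (_ :: _); first by apply: eq_l; lia.
by apply/IHm => j jm; apply: eq_l; lia.
Qed.

Lemma sumn_code f k m : sumn (code f k m) = (\sum_(k <= j < k + m) lehmer f j)%N.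
Proof.
elim: m => [|m IHm] /=; first by rewrite addn0 big_geq.
by rewrite addnS big_nat_recr ?leq_addr //= IHm addnC.
Qed.

Lemma code_majE f k m :
  code_maj k (code f k m.+1) =
  (lehmer f k
   + \sum_(k <= j < k + m) j.+1 * (lehmer f j < lehmer f j.+1))%N.
Proof.
elim: m => [|m IHm]; first by rewrite /= !addn0 big_geq ?addn0.
transitivity ((k + m).+1 * (lehmer f (k + m) < lehmer f (k + m).+1)
              + code_maj k (code f k m.+1))%N.
  by rewrite /= size_code addnS.
by rewrite IHm addnS big_nat_recr ?leq_addr //=; lia.
Qed.

Lemma mem_codes k m r c :
  (r :: c \in codes k m.+1) = (r <= k + m)%N && (c \in codes k m).
Proof.
apply/allpairsP/andP => [[[c' r'] /= [c'm]]|[rm cm]].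
  by rewrite (mem_iota 0 (k + m).+1) => /= r'm [-> ->].
by exists (c, r); rewrite (mem_iota 0 (k + m).+1).
Qed.

Lemma size_mem_codes k m c : c \in codes k m -> size c = m.
Proof.
elim: m c => [|m IHm] c; first by rewrite inE => /eqP->.
by case/allpairsP=> -[c' r] /= [/IHm <- _ ->].
Qed.

Lemma mem_code f k m : code f k m \in codes k m.
Proof. by elim: m => // m IHm; rewrite mem_codes IHm lehmer_le. Qed.

(** With [code_cat], this reduces the surjectivity of partial codes to that of full
codes, which follows by counting. *)
Lemma codes_cat k m c d :
  c \in codes k m -> d \in codes 0 k -> c ++ d \in codes 0 (k + m).
Proof.
move=> + dk; elim: m c => [|m IHm] c.
  by rewrite addn0 inE => /eqP->.
case: c => [/size_mem_codes//|r c]; rewrite mem_codes => /andP[rm /IHm cm].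
by rewrite addnS cat_cons mem_codes add0n rm.
Qed.

Lemma uniq_codes k m : uniq (codes k m).
Proof.
elim: m => // m IHm; apply: allpairs_uniq_dep => // [c _|].
  exact: iota_uniq.
by move=> [c r] [c' r'] _ _ /= [-> ->].
Qed.

Lemma size_codes0 m : size (codes 0 m) = m`!.
Proof.
by elim: m => // m IHm; rewrite /codes -/codes size_allpairs IHm size_iota factS mulnC.
Qed.

(** * Summing over codes *)

(** Adding j to the first r of the exponents 0, ..., j-1 moves the window of
exponents to r, ..., r+j-1. *)
Lemma geometric_shift (R : comNzRingType) (x : R) (j r : nat) : (r <= j)%N ->
  \sum_(s < j) x ^+ s * x ^+ (j * (s < r)) = x ^+ r * qint j x.
Proof.
move=> rj; rewrite /qint -(big_mkord predT (fun s => x ^+ s * x ^+ (j * (s < r)))).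
rewrite -(big_mkord predT (fun s => x ^+ s)).
rewrite (big_cat_nat (n := r)) //= [in RHS](big_cat_nat (n := (j - r)%N)) ?leq_subr //=.
rewrite addrC mulrDr !mulr_sumr; congr (_ + _).
  rewrite -{1}[r]add0n big_addn; apply: eq_big_nat => s /andP[_ sj].
  by rewrite ltnNge leq_addl muln0 expr0 mulr1 addnC exprD.
rewrite -{1}[(j - r)%N]add0n big_addn subKn //; apply: eq_big_nat => s /andP[_ sr].
by rewrite sr muln1 -!exprD; congr (_ ^+ _); lia.
Qed.

Lemma big_codes (R : nmodType) (k m : nat) (F : seq nat -> R) :
  \sum_(c <- codes k m.+1) F c =
  \sum_(c <- codes k m) \sum_(r < (k + m).+1) F (nat_of_ord r :: c).
Proof.
rewrite big_allpairs_dep; apply: eq_bigr => c _.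
by rewrite -[iota 0 _]/(index_iota 0 (k + m).+1) big_mkord.
Qed.

(** The function F of the last entry is arbitrary because summing out the last
entry of a longer code leaves such a function of the preceding entry: it is to
this function, G below, that the induction hypothesis is applied. *)
Lemma code_gf (R : comNzRingType) (q : R) (k m : nat) (F : nat -> R) : odd k ->
  \sum_(c <- codes k m.+1)
     (-1) ^+ sumn c * q ^+ code_maj k c * F (head 0%N c) =
  (\prod_(k.+1 <= j < (k + m).+1) qint j ((-1) ^+ j.-1 * q))
  * \sum_(r < (k + m).+1) ((-1) ^+ (k + m).+2 * q) ^+ r * F r.
Proof.
move=> hk; elim: m F => [|m IHm] F.
  rewrite !addn0 big_geq // mul1r.
  rewrite big_codes big_seq1 addn0; apply: eq_bigr => r _ /=.
  by rewrite addn0 -[(-1) ^+ k.+2]signr_odd /= negbK hk expr1 exprMn.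
rewrite big_codes addnS.
pose j := (k + m).+1.
pose G s := \sum_(r < j.+1) (-1) ^+ r * q ^+ (j * (s < r)) * F r.
transitivity (\sum_(c <- codes k m.+1)
     (-1) ^+ sumn c * q ^+ code_maj k c * G (head 0%N c)).
  rewrite big_seq [RHS]big_seq; apply: eq_bigr => c /size_mem_codes.
  case: c => // r' c sc.
  rewrite mulr_sumr; apply: eq_bigr => r _.
  have -> : code_maj k [:: nat_of_ord r, r' & c] =
      (j * (r' < r) + code_maj k (r' :: c))%N.
    by rewrite -[LHS]/((k + size (r' :: c)) * (r' < r) + code_maj k (r' :: c))%N sc addnS.
  rewrite -[sumn [:: _, _ & _]]/(r + sumn (r' :: c))%N !exprD.
  by rewrite /=; ring.
rewrite IHm [in RHS]big_nat_recr /=; last by rewrite ltnS leq_addr.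
rewrite -mulrA; congr (_ * _).
set x := (-1) ^+ (k + m).+2 * q.
have xE : (-1) ^+ (k + m) * q = x by rewrite /x !exprS; ring.
rewrite xE mulr_sumr; under eq_bigr do rewrite mulr_sumr.
rewrite exchange_big /=; apply: eq_bigr => r _.
(* The sign of x is that of (k + m).+2: if it is -1, the exponent is even. *)
have xj : x ^+ (k + m).+1 = q ^+ (k + m).+1.
  by rewrite /x exprMn -exprM -signr_odd oddM /= negbK andbN expr0 mul1r.
transitivity ((-1) ^+ r * F r *
  \sum_(s < (k + m).+1) x ^+ s * x ^+ ((k + m).+1 * (s < r))).
  rewrite mulr_sumr; apply: eq_bigr => s _.
  by rewrite !exprM xj; ring.
rewrite geometric_shift; last by rewrite -ltnS.
have -> : (-1) ^+ (k + m).+3 * q = - x by rewrite /x exprS; ring.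
by rewrite -[- x]mulN1r [(-1 * x) ^+ r]exprMn; ring.
Qed.

(** * Orbits of labellings and their codes *)

Definition perm_fun {n} (w : 'S_n.+1) (i : nat) : nat := w (inord i).

Lemma lehmer_card n (w : 'S_n.+1) (j : 'I_n.+1) :
  lehmer (perm_fun w) j = #|[set i : 'I_n.+1 | (i < j) && (w j < w i)]%N|.
Proof.
rewrite /lehmer (big_ord_widen n.+1 (fun i => nat_of_bool (perm_fun w j < perm_fun w i)%N)) 1?ltnW //.
rewrite -sum1_card big_mkcond [RHS]big_mkcond; apply: eq_bigr => i _.
by rewrite /perm_fun !inord_val inE; case: ifP => //= _; case: ifP.
Qed.

(** Since u and w agree after j, they use the same set of labels up to j. Among
these labels, those above w j are strictly fewer than those above u j. *)
Lemma lehmer_lt n (u w : 'S_n.+1) (j : 'I_n.+1) :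
  (forall i : 'I_n.+1, (j < i)%N -> u i = w i) -> (u j < w j)%N ->
  (lehmer (perm_fun w) j < lehmer (perm_fun u) j)%N.
Proof.
move=> uw lt_j; rewrite !lehmer_card.
(* A label w i with i <= j is also the label under u of some position <= j, and
   of a position < j when it differs from u j. *)
have before (i : 'I_n.+1) : (i <= j)%N -> (u j < w i)%N -> (u^-1 (w i) < j)%g%N.
  move=> ij lti; set i' := (u^-1 (w i))%g.
  have ui' : u i' = w i by rewrite permKV.
  rewrite ltn_neqAle; apply/andP; split.
    apply/eqP => /val_inj eij; move: lti; rewrite -ui' eij ltnn //.
  rewrite leqNgt; apply/negP => ji'; have := uw _ ji'; rewrite ui' => /perm_inj eii.
  by move: ji'; rewrite -eii ltnNge ij.
rewrite -(card_imset _ (@perm_inj _ w)) -[ltnRHS](card_imset _ (@perm_inj _ u)).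
apply: proper_card; apply/properP; split.
  apply/subsetP => _ /imsetP[i + ->]; rewrite inE => /andP[ij ltw].
  apply/imsetP; exists (u^-1%g (w i)); rewrite ?permKV // inE permKV.
  by rewrite (before i) ?(ltn_trans lt_j ltw) // ltnW.
exists (w j).
  by apply/imsetP; exists (u^-1%g (w j)); rewrite ?permKV // inE permKV lt_j before.
by apply/negP => /imsetP[i + /perm_inj eij]; rewrite inE eij !ltnn.
Qed.

(** Downward induction on j: once the labels after j are known to agree,
[lehmer_lt] excludes both strict inequalities at j. *)
Lemma lehmer_inj_from n (u w : 'S_n.+1) (k : nat) :
  (forall j, k <= j < n.+1 -> lehmer (perm_fun u) j = lehmer (perm_fun w) j)%N ->
  forall j : 'I_n.+1, (k <= j)%N -> u j = w j.
Proof.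
move=> eq_l j; have [d] := ubnP (n - j)%N.
elim: d j => // d IHd j dj kj.
have after (i : 'I_n.+1) : (j < i)%N -> u i = w i.
  by move=> ji; apply: IHd; have := ltn_ord i; lia.
have eq_j := eq_l j (introT andP (conj kj (ltn_ord j))).
apply: val_inj; case: (ltngtP (u j) (w j)) => // lt_j.
  by have := lehmer_lt _ _ _ _ after lt_j; rewrite eq_j ltnn.
have after' (i : 'I_n.+1) : (j < i)%N -> w i = u i by move=> /after.
by have := lehmer_lt _ _ _ _ after' lt_j; rewrite eq_j ltnn.
Qed.

(** For k = 0 the code is injective on the (n+1)! permutations, and there are
(n+1)! codes. A partial code is completed to a full one by the first k entries of
the code of any permutation. *)
Lemma code_surj {n k m} {c : seq nat} : (k + m = n.+1)%N -> c \in codes k m ->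
  exists w : 'S_n.+1, code (perm_fun w) k m = c.
Proof.
move=> kmn cm.
have code_inj : injective (fun w : 'S_n.+1 => code (perm_fun w) 0 n.+1).
  move=> u w /code_lehmerP eq_l; apply/permP => j.
  by apply: (@lehmer_inj_from n u w 0).
have [||| _ all_codes] := uniq_min_size (s1 := [seq code (perm_fun w) 0 n.+1 | w : 'S_n.+1])
  (s2 := codes 0 n.+1).
- by rewrite map_inj_uniq ?enum_uniq.
- by move=> _ /mapP[w _ ->]; apply: mem_code.
- by rewrite size_codes0 size_map -cardT card_Sn.
have := codes_cat _ _ _ _ cm (mem_code (perm_fun (1%g : 'S_n.+1)) 0 k).
rewrite kmn -all_codes => /mapP[w _].
have -> : code (perm_fun w) 0 n.+1 = code (perm_fun w) k m ++ code (perm_fun w) 0 k.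
  by rewrite -code_cat kmn.
move=> /eqP.
rewrite eqseq_cat ?size_code ?(size_mem_codes _ _ _ cm) // => /andP[/eqP-> _].
by exists w.
Qed.

(** Permuting the teeth does not affect how many labels before a chain position
exceed its label. Conversely, equal codes force equal labels on the chain, so the
two labellings differ by a permutation of the teeth. *)
Lemma orbit_codeP {n k m} {u w : 'S_n.+1} : (k + m = n.+1)%N ->
  reflect (code (perm_fun u) k m = code (perm_fun w) k m)
    (w \in orbit (relabel_action n.+1) (Sym (teeth n.+1 k)) u).
Proof.
move=> kmn; apply: (iffP idP) => [/orbitP[s hs <-]|/code_lehmerP].
  apply/code_lehmerP => j; rewrite kmn => /andP[kj jn].
  have sE i : (s i < j)%N = (i < j)%N.
    by have [[-> _]|[ik sik]] := toothE hs i; rewrite // !(leq_trans _ kj).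
  rewrite -[j]/(nat_of_ord (Ordinal jn)) !lehmer_card.
  have sj : s (Ordinal jn) = Ordinal jn.
    by have [[]|[/=]] := toothE hs (Ordinal jn); rewrite // ltnNge kj.
  rewrite -(card_imset _ (@perm_inj _ s)); apply: eq_card => i.
  have -> : i = s (s^-1 i)%g by rewrite permKV.
  rewrite (mem_imset _ _ (@perm_inj _ s)) !inE /= sE /relabel !permM permK.
  by have -> : (s^-1)%g (Ordinal jn) = Ordinal jn by rewrite -{1}sj permK.
rewrite kmn => /lehmer_inj_from eq_uw.
apply/orbitP; exists (u * w^-1)%g; last by rewrite /= /relabel invMg invgK mulgKV.
rewrite inE; apply/subsetP => i; rewrite !inE permM; apply: contraR; rewrite -leqNgt.
by move=> /eq_uw->; rewrite permK.
Qed.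

Lemma big_rake_orbits (R : comNzRingType) n k m (F : seq nat -> R) :
  (k + m = n.+1)%N ->
  \sum_(O in rake_orbits n.+1 k) F (code (perm_fun (repr O)) k m) =
  \sum_(c <- codes k m) F c.
Proof.
move=> kmn; rewrite -big_enum -(big_map (fun O => code (perm_fun (repr O)) k m) predT F) /=.
have repr_orbit (w : 'S_n.+1) :
    repr (orbit (relabel_action n.+1) (Sym (teeth n.+1 k)) w) \in
      orbit (relabel_action n.+1) (Sym (teeth n.+1 k)) w.
  by apply: (mem_repr w); apply: orbit_refl.
apply: perm_big; apply: uniq_perm; last move=> c.
- rewrite map_inj_in_uniq ?enum_uniq // => O1 O2; rewrite !mem_enum.
  move=> /imsetP[u _ ->] /imsetP[w _ ->].
  have /(orbit_codeP kmn) <- := repr_orbit u.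
  have /(orbit_codeP kmn) <- := repr_orbit w.
  by move=> /(orbit_codeP kmn) /orbit_eqP.
- exact: uniq_codes.
apply/mapP/idP => [[O _ ->]|/(code_surj kmn)[w <-]]; first exact: mem_code.
exists (orbit (relabel_action n.+1) (Sym (teeth n.+1 k)) w).
  by rewrite mem_enum imset_f.
exact/(orbit_codeP kmn)/repr_orbit.
Qed.

(** * The statistics of a rake in terms of the code *)

Lemma inversions_rake n k (w : 'S_n.+1) :
  inversions (label (k := k) w) = (\sum_(k <= j < n.+1) lehmer (perm_fun w) j)%N.
Proof.
rewrite /inversions -sum1_card.
under eq_bigl do rewrite inE rake_ltE /label ltnS.
rewrite -(pair_big_dep predT (fun i j : rake n.+1 k =>
  (nat_of_ord i < nat_of_ord j) && (k <= nat_of_ord j) && (w j < w i))%N (fun _ _ => 1%N)) /=.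
rewrite (exchange_big_dep predT) //= big_geq_mkord [RHS]big_mkcond; apply: eq_bigr => j _.
rewrite lehmer_card -sum1_card.
case: (boolP (k <= j)%N) => kj /=; last by rewrite big1 // => i; rewrite andbF.
by apply: eq_bigl => i; rewrite inE andbT.
Qed.

(** The single formula covers both the teeth, which are covered by the bottom k of
the chain, and the chain elements, which are covered by their successor. *)
Lemma covered_rake n k (x y : rake n k) :
  covered_by x y = (nat_of_ord y == maxn k (nat_of_ord x).+1).
Proof.
rewrite /covered_by rake_ltE; apply/andP/eqP => [[/andP[xy ky] /existsP no_z]|yE].
  have [lt|] := ltnP (maxn k x.+1) y; last by lia.
  case: no_z; exists (Ordinal (ltn_trans lt (ltn_ord y))).
  by rewrite !rake_ltE /=; lia.
split; first by lia.
by apply/existsP => -[z]; rewrite !rake_ltE; lia.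
Qed.

Lemma descent_rake n k (w : 'S_n.+1) (x : rake n.+1 k) :
  descent (label (k := k) w) x =
  (maxn k x.+1 <= n)%N && (perm_fun w (maxn k x.+1) < w x)%N.
Proof.
rewrite /descent /label; apply/existsP/andP => [[y /andP[]]|[le_n lt_w]].
  rewrite covered_rake ltnS => /eqP <-; rewrite /perm_fun inord_val.
  by move=> lt_w; split; rewrite // -ltnS.
exists (inord (maxn k x.+1)); rewrite covered_rake inordK ?ltnS ?eqxx //.
Qed.

Lemma hook_length_rake n k (x : rake n k) :
  hook_length x = if (x < k)%N then 1%N else x.+1.
Proof.
rewrite /hook_length -sum1_card.
under eq_bigl do rewrite inE Order.POrderTheory.le_eqVlt rake_ltE.
case: ltnP => kx.
  rewrite (eq_bigl (pred1 x)) ?big_pred1_eq // => a.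
  by rewrite andbF orbF.
rewrite -[RHS]card_ord -[RHS]sum1_card (big_ord_widen n (fun _ => 1%N)) //.
by apply: eq_bigl => a; rewrite andbT ltnS [RHS]leq_eqVlt.
Qed.

(** The term [lehmer (perm_fun w) k] counts the descents among the teeth, each of
hook length 1. *)
Lemma maj_rake n k (w : 'S_n.+1) : (k <= n)%N ->
  maj (label (k := k) w) =
  (lehmer (perm_fun w) k
   + \sum_(k <= j < n) j.+1 * (lehmer (perm_fun w) j < lehmer (perm_fun w) j.+1))%N.
Proof.
move=> kn; rewrite /maj big_mkcond /=.
pose F (x : nat) : nat :=
  if (maxn k x.+1 <= n)%N && (perm_fun w (maxn k x.+1) < perm_fun w x)%N
  then (if (x < k)%N then 1%N else x.+1) else 0%N.
rewrite (eq_bigr (fun x : rake n.+1 k => F x)) => [|x _]; last first.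
  by rewrite descent_rake hook_length_rake /F /(perm_fun w x) inord_val.
rewrite -(big_mkord predT F) (big_cat_nat (n := k)) ?(leqW kn) //=.
rewrite big_nat_recr //= [F n]/F (_ : maxn k n.+1 <= n = false)%N ?addn0; last by lia.
congr (_ + _)%N.
  rewrite big_mkord; apply: eq_bigr => x _.
  by rewrite /F (maxn_idPl _) // kn ltn_ord /=; case: ifP.
apply: eq_big_nat => x /andP[kx xn].
rewrite /F (maxn_idPr _) ?(leqW kx) // xn lehmer_descent [(x < k)%N]ltnNge kx /=.
by case: ifP; rewrite ?muln1 ?muln0.
Qed.

(** Both sides count the labels above that of the top: all of these sit at earlier
positions. *)
Lemma rake_r_lehmer n k (hkn : (k < n.+1)%N) (w : 'S_n.+1) :
  rake_r hkn w = lehmer (perm_fun w) n.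
Proof.
rewrite -[n in RHS]/(nat_of_ord (rake_top hkn)) lehmer_card /rake_r /label subSS.
set j : 'I_n.+1 := rake_top hkn.
transitivity #|[set a : 'I_n.+1 | (w j < a)%N]|.
  rewrite -sum1_card; under eq_bigl do rewrite inE.
  by rewrite -(big_geq_mkord _ _ predT (fun _ => 1%N)) sum_nat_const_nat muln1 subSS.
rewrite -[RHS](card_imset _ (@perm_inj _ w)); apply: eq_card => a.
have -> : a = w (w^-1 a)%g by rewrite permKV.
rewrite (mem_imset _ _ (@perm_inj _ w)) !inE permKV.
case: ltnP => lt_wa; rewrite ?andbF ?andbT //.
apply/esym; rewrite ltn_neqAle -ltnS ltn_ord andbT.
apply/eqP => /val_inj ja; by move: lt_wa; rewrite -ja permKV ltnn.
Qed.

Theorem proposition4p2 (R : comNzRingType) (n k : nat) (hk : odd k)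
    (hkn : (k < n)%N) (q t : R) :
  rake_gf hkn q t =
  (\prod_(k.+1 <= j < n) qint j ((-1) ^+ j.-1 * q))
  * qint n ((-1) ^+ n.+1 * (q * t)).
Proof.
have [m mE] : {m | n = (k + m).+1} by exists (n - k.+1)%N; lia.
subst n.
pose F c : R := (-1) ^+ sumn c * q ^+ code_maj k c * t ^+ head 0%N c.
transitivity (\sum_(O in rake_orbits (k + m).+1 k) F (code (perm_fun (repr O)) k m.+1)).
  apply: eq_bigr => O _; rewrite /F inversions_rake maj_rake ?leq_addr //.
  by rewrite rake_r_lehmer sumn_code code_majE addnS.
rewrite big_rake_orbits ?addnS // (code_gf _ _ _ _ (fun r => t ^+ r)) //.
congr (_ * _); apply: eq_bigr => r _.
by rewrite [in RHS]mulrA [in RHS]exprMn.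
Qed.
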